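(* The minimum semidefinite rank of the Heawood graph is $10$.
   Context: For an $n\times n$ Hermitian matrix $A$, the graph of $A$ is the simple graph on vertices $v_1,\dots,v_n$ in which, for $i\neq j$, $v_i$ and $v_j$ are adjacent if and only if $A_{ij}\neq 0$. The minimum semidefinite rank $\operatorname{msr}(G)$ of a simple graph $G$ is the smallest rank among all positive semidefinite Hermitian matrices whose graph is $G$; equivalently, it is the smallest $d$ such that there is a map $r:V(G)\to\mathbb{C}^d$ with $\langle r(u),r(v)\rangle\neq 0$ if and only if $\{u,v\}\in E(G)$, for all distinct $u,v$. The Fano plane is the point-line structure on points $\{1,\dots,7\}$ with lines $\{1,2,6\},\{2,3,7\},\{1,3,4\},\{2,4,5\},\{3,5,6\},\{4,6,7\},\{1,5,7\}$. The Heawood graph is its point-line incidence graph: a bipartite graph on $14$ vertices, one vertex for each point and one for each line, with a point-vertex adjacent to a line-vertex exactly when the point lies on the line. *)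

(* Defs.v *)
From mathcomp Require Import all_boot all_order all_algebra.
From mathcomp Require Import boolp reals.
From mathcomp Require Import complex.

Set Implicit Arguments.
Unset Strict Implicit.
Unset Printing Implicit Defensive.

Import Order.TTheory GRing.Theory Num.Theory.
Local Open Scope ring_scope.
Local Open Scope sesquilinear_scope.

Record sgraph := SGraph {
  vertex :> finType;
  adj : rel vertex;
  adj_sym : symmetric adj;
  adj_irrefl : irreflexive adj
}.

Definition mx_adj (C : numClosedFieldType) (n : nat) (A : 'M[C]_n) : rel 'I_n :=
  fun i j => (i != j) && (A i j != 0).

(* Matrices whose graph is G are indexed by the library enumeration of the
   vertices of G. *)
Definition has_graph (C : numClosedFieldType) (G : sgraph) (A : 'M[C]_#|G|) :
    Prop :=
  forall u v : G, mx_adj A (enum_rank u) (enum_rank v) = adj u v.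

(* `x <= y` in C means that y - x is real and nonnegative. *)
Definition psdmx (C : numClosedFieldType) (n : nat) (A : 'M[C]_n) : Prop :=
  A \is hermsymmx /\ forall x : 'cV[C]_n, 0 <= (x^t* *m A *m x) 0 0.

Definition psd_rank (R : realType) (G : sgraph) (d : nat) : Prop :=
  exists A : 'M[R[i]]_#|G|, [/\ psdmx A, has_graph A & \rank A = d].

Lemma gram_psdmx (C : numClosedFieldType) (n m : nat) (N : 'M[C]_(n, m)) :
  psdmx (N *m N^t*).
Proof.
split.
  apply/is_hermitianmxP; rewrite expr0 scale1r trmx_mul map_mxM /=.
  by congr (_ *m _); rewrite trmxCK.
move=> x; have -> : x^t* *m (N *m N^t*) *m x = (x^t* *m N) *m (x^t* *m N)^t*.
  by rewrite trmx_mul map_mxM /= trmxCK !mulmxA.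
rewrite mxE; apply: sumr_ge0 => k _.
by rewrite !mxE mul_conjC_ge0.
Qed.

(* Every graph is the graph of its signless Laplacian, which is positive
   semidefinite. *)
Lemma psd_rank_exists (R : realType) (G : sgraph) :
  exists d, `[< psd_rank R G d >].
Proof.
pose f (u : G) (p : G * G) : nat := adj p.1 p.2 && ((u == p.1) || (u == p.2)).
pose N : 'M[R[i]]_(#|G|, #|{: G * G}|) :=
  \matrix_(i, k) (f (enum_val i) (enum_val k))%:R.
exists (\rank (N *m N^t*)); apply/asboolP; exists (N *m N^t*).
split=> //; first exact: gram_psdmx.
move=> u v; rewrite /mx_adj (inj_eq enum_rank_inj).
have -> : (N *m N^t*) (enum_rank u) (enum_rank v) =
    (\sum_(p : G * G) f u p * f v p)%N%:R.
  rewrite mxE natr_sum (reindex (@enum_val _ {: G * G})) /=; last first.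
    exact/onW_bij/enum_val_bij.
  apply: eq_bigr => k _.
  by rewrite !mxE !enum_rankK conjC_nat natrM.
rewrite pnatr_eq0 sum_nat_eq0 negb_forall.
apply/andP/idP => [[uv /existsP[[a b]]]|uv].
  rewrite /f /= muln_eq0 negb_or !eqb0 !negbK.
  move=> /andP[/andP[ab /orP ua] /andP[_ /orP va]]; move: uv.
  case: ua va => /eqP-> [] /eqP->; rewrite ?eqxx // => _.
  by rewrite adj_sym.
split; first by apply: contraTneq uv => ->; rewrite adj_irrefl.
by apply/existsP; exists (u, v); rewrite /f /= uv !eqxx orbT.
Qed.

Definition msr (R : realType) (G : sgraph) : nat :=
  ex_minn (psd_rank_exists R G).

Definition fano_lines : seq (seq nat) :=
  [:: [:: 1; 2; 6]; [:: 2; 3; 7]; [:: 1; 3; 4]; [:: 2; 4; 5];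
      [:: 3; 5; 6]; [:: 4; 6; 7]; [:: 1; 5; 7]]%N.

(* Points and lines are indexed from 0: `p` stands for the point p.+1. *)
Definition fano_incident (p l : 'I_7) : bool :=
  p.+1 \in nth [::] fano_lines l.

(* `inl` are the point-vertices, `inr` the line-vertices. *)
Definition heawood_adj (u v : 'I_7 + 'I_7) : bool :=
  match u, v with
  | inl p, inr l | inr l, inl p => fano_incident p l
  | _, _ => false
  end.

Lemma heawood_adj_sym : symmetric heawood_adj.
Proof. by move=> [p|l] [q|m]. Qed.

Lemma heawood_adj_irrefl : irreflexive heawood_adj.
Proof. by move=> [p|l]. Qed.

Definition heawood : sgraph := SGraph heawood_adj_sym heawood_adj_irrefl.

(* Main.v *)
Require Import Defs.
From mathcomp Require Import all_boot all_order all_algebra.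
From mathcomp Require Import reals.
From mathcomp Require Import boolp complex ring.

(* Represent a positive semidefinite matrix with graph the Heawood graph as the
   Gram matrix of vectors of C^d.  The seven point-vectors are orthogonal and
   nonzero; projecting the line-vectors on their orthogonal complement gives
   seven vectors w_l of C^(d-7) with <w_l, w_m> = - b_lp conj(b_mp) / d_p, where
   p is the common point of l and m.  Hence
     <w_l, w_m> <w_m, w_k> <w_k, w_l> < 0
   for the three lines l, m, k through any point.  In C^2 this says that the
   Bloch vectors of w_l, w_m, w_k in R^3 are coplanar and satisfy a linear
   relation with positive coefficients, so a linear form cannot have the same
   sign at all three: its sign would be a proper 2-colouring of the Fano plane,
   and there is none.  Thus d - 7 > 2.  Conversely, seven vectors of R^3 with
   negative triple products give a representation in dimension 10. *)

Set Implicit Arguments.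
Unset Strict Implicit.
Unset Printing Implicit Defensive.

Import Order.TTheory GRing.Theory Num.Theory.
Local Open Scope ring_scope.
Local Open Scope sesquilinear_scope.

(** * Gram factorizations of positive semidefinite matrices *)

Lemma psdmx_conj (C : numClosedFieldType) (m n : nat) (A : 'M[C]_n)
    (P : 'M[C]_(n, m)) :
  psdmx A -> psdmx (P^t* *m A *m P).
Proof.
move=> [hA pA]; split.
  apply/is_hermitianmxP; rewrite expr0 scale1r !trmx_mul !map_mxM /= trmxCK.
  by move/is_hermitianmxP: hA; rewrite expr0 scale1r => <-; rewrite mulmxA.
move=> x; have := pA (P *m x).
by rewrite trmx_mul map_mxM /= !mulmxA.
Qed.

Lemma psdmx_gram (C : numClosedFieldType) (n : nat) (A : 'M[C]_n) :
  psdmx A -> exists N : 'M[C]_n, A = N *m N^t*.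
Proof.
move=> psA; have [hA _] := psA.
have /orthomx_spectralP := hermitian_normalmx hA.
set P := spectralmx A; set d := spectral_diag A => AE.
have uP : P \is unitarymx by exact: spectral_unitarymx.
have dE : diag_mx d = (P^t*)^t* *m A *m P^t*.
  by rewrite trmxCK AE (invmx_unitary uP) !mulmxA (unitarymxP uP) mul1mx
             -mulmxA (unitarymxP uP) mulmx1.
(* The eigenvalues are diagonal entries of a conjugate of [A], hence nonnegative, and have real
   square roots. *)
have d_ge0 k : 0 <= d 0 k.
  have [_ /(_ (delta_mx k 0))] := psdmx_conj (P^t*) psA; rewrite -dE.

  rewrite -mulmxA -colE trmx_delta.
  have -> : map_mx Num.conj (delta_mx 0 k : 'rV[C]_n) = delta_mx 0 k.
    by apply/matrixP => i j; rewrite !mxE conjC_nat.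
  by rewrite -rowE !mxE eqxx.
pose s := \row_k sqrtC (d 0 k).
exists (P^t* *m diag_mx s).
rewrite trmx_mul map_mxM /= trmxCK [LHS]AE (invmx_unitary uP) !mulmxA.
congr (_ *m _); rewrite -mulmxA; congr (_ *m _).
rewrite tr_diag_mx map_diag_mx mulmx_diag; congr diag_mx.
apply/rowP => k; rewrite !mxE /=.
have /geC0_conj -> : 0 <= sqrtC (d 0 k) by rewrite sqrtC_ge0.
by rewrite -expr2 sqrtCK.
Qed.

(** With [R] a row basis of [A] and [R'] a right inverse of it, Hermitian symmetry gives A = R^*
    (R'^* A R') R. The inner matrix has size the rank of [A]; its Gram factor is padded with zero
    columns by [pid_mx]. *)
Lemma psdmx_gram_rank (C : numClosedFieldType) (n r : nat) (A : 'M[C]_n) :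
  psdmx A -> (\rank A <= r)%N -> exists N : 'M[C]_(n, r), A = N *m N^t*.
Proof.
move=> psA; have [hA _] := psA.
have AC : A^t* = A by move/is_hermitianmxP: hA; rewrite expr0 scale1r.
have := row_base_free A; have : (A <= row_base A)%MS by rewrite eq_row_base.
move: (\rank A) (row_base A) => k R /submxP[K AK] /row_freeP[R' RR'] kr.
have ARR : A = A *m R' *m R.
  by rewrite [in RHS]AK -!mulmxA (mulmxA R) RR' mul1mx.
have AE : A = R^t* *m (R'^t* *m A *m R') *m R.
  rewrite -!mulmxA (mulmxA A) -ARR -{1}AC {1}ARR !trmx_mul !map_mxM /= AC.
  by rewrite mulmxA.
have [N HN] := psdmx_gram (psdmx_conj R' psA).
exists (R^t* *m N *m pid_mx k).
have pidE : pid_mx k *m (pid_mx k : 'M[C]_(k, r))^t* = 1%:M.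
  by rewrite tr_pid_mx map_pid_mx mul_pid_mx minnn (minn_idPr _) // pid_mx_1.
rewrite !trmx_mul !map_mxM /= trmxCK -!mulmxA (mulmxA (pid_mx _)) pidE mul1mx.
by rewrite {1}AE HN !mulmxA.
Qed.

(** * Positive linear dependences in R^3 and Bloch vectors *)

(** Cauchy-Schwarz, by Lagrange's identity. *)
Lemma dot3_ge (R : realFieldType) (x1 y1 z1 r1 x2 y2 z2 r2 : R) :
  0 <= r1 -> 0 <= r2 ->
  r1 ^+ 2 = x1 ^+ 2 + y1 ^+ 2 + z1 ^+ 2 ->
  r2 ^+ 2 = x2 ^+ 2 + y2 ^+ 2 + z2 ^+ 2 ->
  0 <= x1 * x2 + y1 * y2 + z1 * z2 + r1 * r2.
Proof.
move=> r1_ge0 r2_ge0 e1 e2; set m := _ + z1 * z2.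
rewrite -[_ * _]opprK subr_ge0.
rewrite lerNl (le_trans (ler_norm _)) // normrN.
rewrite -(@ler_pXn2r _ 2) ?nnegrE ?mulr_ge0 // real_normK ?num_real //.
rewrite exprMn e1 e2 -subr_ge0.
rewrite (_ : _ - _ = (y1 * z2 - y2 * z1) ^+ 2 + (x1 * z2 - x2 * z1) ^+ 2
           + (x1 * y2 - x2 * y1) ^+ 2); last by rewrite /m; ring.
by rewrite !addr_ge0 ?sqr_ge0.
Qed.

(* [a, b, c] is a row of the adjugate of the Gram matrix of the three vectors,
   which is singular. *)
Lemma coplanar_pos_dep (R : realFieldType)
    (x1 y1 z1 r1 x2 y2 z2 r2 x3 y3 z3 r3 : R)
    (m12 := x1 * x2 + y1 * y2 + z1 * z2)
    (m13 := x1 * x3 + y1 * y3 + z1 * z3)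
    (m23 := x2 * x3 + y2 * y3 + z2 * z3)
    (det := x1 * (y2 * z3 - y3 * z2) - y1 * (x2 * z3 - x3 * z2)
            + z1 * (x2 * y3 - x3 * y2)) :
  0 <= r1 -> 0 <= r2 -> 0 <= r3 ->
  r1 ^+ 2 = x1 ^+ 2 + y1 ^+ 2 + z1 ^+ 2 ->
  r2 ^+ 2 = x2 ^+ 2 + y2 ^+ 2 + z2 ^+ 2 ->
  r3 ^+ 2 = x3 ^+ 2 + y3 ^+ 2 + z3 ^+ 2 ->
  det = 0 -> r1 * r2 * r3 + r3 * m12 + r1 * m23 + r2 * m13 < 0 ->
  exists a b c : R, [/\ 0 < a, 0 < b & 0 < c] /\
    [/\ a * x1 + b * x2 + c * x3 = 0, a * y1 + b * y2 + c * y3 = 0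
      & a * z1 + b * z2 + c * z3 = 0].
Proof.
move=> r1ge r2ge r3ge e1 e2 e3 det0 S0.
have h12 : 0 <= m12 + r1 * r2 by exact: dot3_ge.
have h13 : 0 <= m13 + r1 * r3 by exact: dot3_ge.
have h23 : 0 <= m23 + r2 * r3 by exact: dot3_ge.
have r2_gt0 : 0 < r2.
  rewrite lt_def r2ge andbT; apply: contraTneq S0 => r20.
  move: h12 h23; rewrite r20 mulr0 !mul0r !addr0 add0r => h12 h23.
  by rewrite -leNgt addr_ge0 ?mulr_ge0.
have r3_gt0 : 0 < r3.
  rewrite lt_def r3ge andbT; apply: contraTneq S0 => r30.
  move: h13 h23; rewrite r30 !mulr0 mul0r !addr0 add0r => h13 h23.
  by rewrite -leNgt addr_ge0 ?mulr_ge0.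
set S := _ + _ in S0.
pose a := (y2 * z3 - y3 * z2) ^+ 2 + (x2 * z3 - x3 * z2) ^+ 2
             + (x2 * y3 - x3 * y2) ^+ 2.
pose b := m23 * m13 - m12 * r3 ^+ 2.
pose c := m12 * m23 - m13 * r2 ^+ 2.
have b0 : 0 < b.
  (* Both brackets are nonnegative by [dot3_ge], so the negativity of [S] makes [b] positive. *)
  have -> : b = (m23 + r2 * r3) * (m13 + r1 * r3) + r3 * - S.
    by rewrite /b /S; ring.
  by rewrite ltr_wpDl ?mulr_ge0 // mulr_gt0 // oppr_gt0.
have c0 : 0 < c.
  have -> : c = (m12 + r1 * r2) * (m23 + r2 * r3) + r2 * - S.
    by rewrite /c /S; ring.
  by rewrite ltr_wpDl ?mulr_ge0 // mulr_gt0 // oppr_gt0.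
have a0 : 0 < a.
  rewrite lt_def; apply/andP; split; last by rewrite !addr_ge0 ?sqr_ge0.
  apply: contraTneq b0 => a0.
  (* Jacobi's identity for a 2 by 2 minor of the adjugate of the Gram matrix, whose determinant is
     [det ^+ 2]. *)
  have : b ^+ 2 = a * ((y1 * z3 - y3 * z1) ^+ 2 + (x1 * z3 - x3 * z1) ^+ 2
             + (x1 * y3 - x3 * y1) ^+ 2) - r3 ^+ 2 * det ^+ 2.
    by rewrite /b /a /det e3 /m23 /m13 /m12; ring.
  rewrite a0 det0 mul0r expr0n mulr0 subrr => /eqP.
  by rewrite sqrf_eq0 => /eqP ->; rewrite ltxx.
exists a, b, c; split=> //; split.
- have -> : a * x1 + b * x2 + c * x3 = det * (y2 * z3 - y3 * z2).
    by rewrite /a /b /c /det e3 e2 /m23 /m13 /m12; ring.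
  by rewrite det0 mul0r.
- have -> : a * y1 + b * y2 + c * y3 = - det * (x2 * z3 - x3 * z2).
    by rewrite /a /b /c /det e3 e2 /m23 /m13 /m12; ring.
  by rewrite det0 oppr0 mul0r.
- have -> : a * z1 + b * z2 + c * z3 = det * (x2 * y3 - x3 * y2).
    by rewrite /a /b /c /det e3 e2 /m23 /m13 /m12; ring.
  by rewrite det0 mul0r.
Qed.

(* Lexicographic positivity replaces the sign of a linear form vanishing at none
   of the vectors. *)
Definition lexpos (R : realFieldType) (v : R * R * R) : bool :=
  (0 < v.1.1) || (v.1.1 == 0) && ((0 < v.1.2) || (v.1.2 == 0) && (0 < v.2)).

(** The first coordinates are nonnegative and a positive combination of them vanishes, so all are
    zero. The same then holds for the second coordinates, which leaves third coordinates that are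
    positive. *)
Lemma lexpos_dep (R : realFieldType) (a b c : R) (u v w : R * R * R) :
  0 < a -> 0 < b -> 0 < c -> lexpos u -> lexpos v -> lexpos w ->
  a * u.1.1 + b * v.1.1 + c * w.1.1 = 0 ->
  a * u.1.2 + b * v.1.2 + c * w.1.2 = 0 ->
  a * u.2 + b * v.2 + c * w.2 = 0 -> False.
Proof.
case: u v w => [[x1 y1] z1] [[x2 y2] z2] [[x3 y3] z3] a0 b0 c0.
have pos3 (p q r : R) : 0 <= p -> 0 <= q -> 0 <= r ->
    a * p + b * q + c * r = 0 -> [/\ p = 0, q = 0 & r = 0].
  move=> p0 q0 r0 /eqP; rewrite !paddr_eq0 ?addr_ge0 ?mulr_ge0
    ?(ltW a0) ?(ltW b0) ?(ltW c0) //.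
  rewrite !mulf_eq0 !(gt_eqF a0, gt_eqF b0, gt_eqF c0) /=.
  by move=> /andP[/andP[/eqP-> /eqP->] /eqP->].
have wk (x : R) (B : bool) : (0 < x) || (x == 0) && B -> 0 <= x.
  by case: ltgtP.
have tl (x : R) (B : bool) : x = 0 -> (0 < x) || (x == 0) && B -> B.
  by move=> ->; rewrite ltxx eqxx.
rewrite /lexpos /= => u0 v0 w0.
move=> /pos3[]; [exact: wk u0|exact: wk v0|exact: wk w0|].
move=> /tl/(_ u0){}u0 /tl/(_ v0){}v0 /tl/(_ w0){}w0.
move=> /pos3[]; [exact: wk u0|exact: wk v0|exact: wk w0|].
move=> /tl/(_ u0){}u0 /tl/(_ v0){}v0 /tl/(_ w0){}w0.
move=> /pos3[]; [exact: ltW u0|exact: ltW v0|exact: ltW w0|] => u00 _ _.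
by rewrite u00 ltxx in u0.
Qed.

Lemma lexpos_opp (R : realFieldType) (x y z : R) :
  ~~ lexpos (x, y, z) -> (x, y, z) <> (0, 0, 0) -> lexpos (- x, - y, - z).
Proof.
rewrite /lexpos /= !oppr_gt0 !oppr_eq0 => + nz.
case: ltgtP => //= x0; case: ltgtP => //= y0; case: ltgtP => //= z0.
by case: nz; rewrite -x0 -y0 -z0.
Qed.

(* The vector (|x|^2 - |y|^2, 2 Re (conj(x) y), 2 Im (conj(x) y)), that is, the
   Bloch vector of (x, y) with its third coordinate moved to the front. *)
Definition bloch (R : rcfType) (x y : R[i]) : R * R * R :=
  let: Complex a b := x in let: Complex c d := y in
  (a ^+ 2 + b ^+ 2 - c ^+ 2 - d ^+ 2,
   2 * (a * c + b * d), 2 * (a * d - b * c)).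

(** Let T be the triple product and r_i = |x_i|^2 + |y_i|^2 the norms of the Bloch vectors n_i. Then
    4 Re T = r_1 r_2 r_3 + r_3 n_1.n_2 + r_1 n_2.n_3 + r_2 n_1.n_3, and -4 Im T is the determinant
    of the n_i, so [coplanar_pos_dep] applies. *)
Lemma bloch_pos_dep (R : rcfType) (x1 y1 x2 y2 x3 y3 : R[i])
    (u := bloch x1 y1) (v := bloch x2 y2) (w := bloch x3 y3) :
  (x1 * x2^* + y1 * y2^*) * (x2 * x3^* + y2 * y3^*) * (x3 * x1^* + y3 * y1^*)
    < 0 ->
  exists a b c : R, [/\ 0 < a, 0 < b & 0 < c] /\
    [/\ a * u.1.1 + b * v.1.1 + c * w.1.1 = 0,
        a * u.1.2 + b * v.1.2 + c * w.1.2 = 0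
      & a * u.2 + b * v.2 + c * w.2 = 0].
Proof.
rewrite {}/u {}/v {}/w.
case: x1 y1 x2 y2 x3 y3 => [a1 b1] [c1 d1] [a2 b2] [c2 d2] [a3 b3] [c3 d3].
have cE (a b : R) : (Complex a b)^* = Complex a (- b) by [].
rewrite !cE; simpc => /andP[/eqP im re].
apply: (@coplanar_pos_dep R _ _ _ (a1 ^+ 2 + b1 ^+ 2 + c1 ^+ 2 + d1 ^+ 2)
   _ _ _ (a2 ^+ 2 + b2 ^+ 2 + c2 ^+ 2 + d2 ^+ 2)
   _ _ _ (a3 ^+ 2 + b3 ^+ 2 + c3 ^+ 2 + d3 ^+ 2)).
1-3: by rewrite !addr_ge0 ?sqr_ge0.
1-3: by rewrite /bloch /=; ring.
- rewrite /bloch /=; move: im; set I := (X in 0 = X); move=> im.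
  by rewrite -[RHS](mulr0 (- 4)) {}im /I; ring.
- rewrite /bloch /=; move: re; set r := (X in X < 0) => re.
  rewrite (_ : _ + _ = 4 * r); first by rewrite pmulr_rlt0.
  by rewrite /r; ring.
Qed.

(** * The Fano plane, and the obstruction in C^2 *)

Lemma fano_not_two_colorable (c : 'I_7 -> bool) :
  exists p l m k, [/\ uniq [:: l; m; k],
    all (fano_incident p) [:: l; m; k], c l = c m & c m = c k].
Proof.
have wit (p l m k : nat) (hp : (p < 7)%N) (hl : (l < 7)%N) (hm : (m < 7)%N)
    (hk : (k < 7)%N) : uniq [:: l; m; k] ->
    all (fun i => p.+1 \in nth [::] fano_lines i) [:: l; m; k] ->
    c (Ordinal hl) = c (Ordinal hm) -> c (Ordinal hm) = c (Ordinal hk) ->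
    exists p l m k, [/\ uniq [:: l; m; k],
      all (fano_incident p) [:: l; m; k], c l = c m & c m = c k].
  by move=> *; exists (Ordinal hp), (Ordinal hl), (Ordinal hm), (Ordinal hk).
(* Each point with its three lines, counted from 0; all 128 colourings are then tried. *)
move: (@wit 0 0 2 6 isT isT isT isT isT isT)
  (@wit 1 0 1 3 isT isT isT isT isT isT)
  (@wit 2 1 2 4 isT isT isT isT isT isT)
  (@wit 3 2 3 5 isT isT isT isT isT isT)
  (@wit 4 3 4 6 isT isT isT isT isT isT)
  (@wit 5 0 4 5 isT isT isT isT isT isT)
  (@wit 6 1 5 6 isT isT isT isT isT isT).
case: (c (@Ordinal 7 0 isT)); case: (c (@Ordinal 7 1 isT));
case: (c (@Ordinal 7 2 isT)); case: (c (@Ordinal 7 3 isT));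
case: (c (@Ordinal 7 4 isT)); case: (c (@Ordinal 7 5 isT));
case: (c (@Ordinal 7 6 isT)) => w0 w1 w2 w3 w4 w5 w6;
by [exact: w0|exact: w1|exact: w2|exact: w3|exact: w4|exact: w5|exact: w6].
Qed.

Lemma fano_lines_meet (l m p q : 'I_7) :
  l != m -> fano_incident p l -> fano_incident p m ->
  fano_incident q l -> fano_incident q m -> p = q.
Proof.
pose on (p l : nat) := p.+1 \in nth [::] fano_lines l.
have chk : all (fun l => all (fun m => all (fun p => all (fun q =>
    [&& l != m, on p l, on p m, on q l & on q m] ==> (p == q))
    (iota 0 7)) (iota 0 7)) (iota 0 7)) (iota 0 7) by vm_compute.
have io (i : 'I_7) : (i : nat) \in iota 0 7 by rewrite mem_iota ltn_ord.
move=> lm pl pm ql qm; apply/val_inj/eqP.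
apply: (implyP (allP (allP (allP (allP chk _ (io l)) _ (io m)) _ (io p))
  _ (io q))).
exact/and5P.
Qed.

(** The Bloch vector has Euclidean norm |x|^2 + |y|^2. *)
Lemma bloch_eq0 (R : rcfType) (x y : R[i]) :
  bloch x y = (0, 0, 0) -> x = 0 /\ y = 0.
Proof.
case: x y => [a b] [c d] [e1 e2 e3].
have : (a ^+ 2 + b ^+ 2 + c ^+ 2 + d ^+ 2) ^+ 2 = 0.
  transitivity ((a ^+ 2 + b ^+ 2 - c ^+ 2 - d ^+ 2) ^+ 2
    + (2 * (a * c + b * d)) ^+ 2 + (2 * (a * d - b * c)) ^+ 2); first by ring.
  by rewrite e1 e2 e3 expr0n /= !addr0.
move/eqP; rewrite expf_eq0 /= !paddr_eq0 ?addr_ge0 ?sqr_ge0 // !sqrf_eq0.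
by move=> /andP[/andP[/andP[/eqP-> /eqP->] /eqP->] /eqP->].
Qed.

Lemma no_planar_fano_gram (R : rcfType) (V : 'M[R[i]]_(7, 2)) (M := V *m V^t*) :
  (forall p l m k, uniq [:: l; m; k] -> all (fano_incident p) [:: l; m; k] ->
     M l m * M m k * M k l < 0) -> False.
Proof.
move=> neg; pose n l := bloch (V l 0) (V l 1).
have ME l m : M l m = V l 0 * (V m 0)^* + V l 1 * (V m 1)^*.
  rewrite mxE !big_ord_recl big_ord0 addr0 !mxE /=.
  by congr (_ + V _ _ * (V _ _)^*); apply: val_inj.
have [p [l [m [k [u inc lm mk]]]]] :=
  fano_not_two_colorable (fun l => lexpos (n l)).
have := neg _ _ _ _ u inc; rewrite !ME => T.
have [a [b [c [[a0 b0 c0] [e1 e2 e3]]]]] := bloch_pos_dep T.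
have [pl|npl] := boolP (lexpos (n l)).
  by apply: (lexpos_dep a0 b0 c0 pl _ _ e1 e2 e3); rewrite -/(n _) -?mk -lm.
(* Otherwise none of the three is lexicographically positive. They are nonzero because their rows
   have nonzero inner products, so their opposites are positive. *)
have n0 i : V i 0 * (V i 0)^* + V i 1 * (V i 1)^* != 0 -> n i <> (0, 0, 0).
  by apply: contra_neq_not => /bloch_eq0[-> ->]; rewrite !mul0r addr0.
have r0 i j : M i j != 0 -> V i 0 * (V i 0)^* + V i 1 * (V i 1)^* != 0.
  rewrite ME; apply: contra_neq => /eqP.
  rewrite paddr_eq0 ?mul_conjC_ge0 // !mul_conjC_eq0 => /andP[/eqP-> /eqP->].
  by rewrite !mul0r addr0.
have := T; rewrite -!ME => /ltr0_neq0; rewrite !mulf_eq0 !negb_or.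
move=> /andP[/andP[/r0/n0 nl /r0/n0 nm] /r0/n0 nk].
have opp i : lexpos (n i) = lexpos (n l) -> n i <> (0, 0, 0) ->
    lexpos (- (n i).1.1, - (n i).1.2, - (n i).2).
  move=> il ni; apply: lexpos_opp; first by rewrite -!surjective_pairing il.
  by rewrite -!surjective_pairing.
apply: (lexpos_dep a0 b0 c0 (opp l _ nl) (opp m _ nm) (opp k _ nk)) => //=.
- by rewrite -mk -lm.
- by rewrite !mulrN -!opprD e1 oppr0.
- by rewrite !mulrN -!opprD e2 oppr0.
- by rewrite !mulrN -!opprD e3 oppr0.
Qed.

(** * Projection off the point-vectors, and the lower bound *)

Lemma gram_entry (C : numClosedFieldType) (m n r : nat) (X : 'M[C]_(m, r))
    (Y : 'M[C]_(n, r)) i j :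
  (X *m Y^t*) i j = \sum_k X i k * (Y j k)^*.
Proof. by rewrite mxE; apply: eq_bigr => k _; rewrite !mxE. Qed.

Lemma fano_point_on_line (p : 'I_7) : exists l, fano_incident p l.
Proof.
have /allP F : all (fun p => has (fun l => p.+1 \in l) fano_lines) (iota 0 7).
  by [].
have hp : has (fun l => p.+1 \in l) fano_lines.
  by apply: F; rewrite mem_iota ltn_ord.
have lt7 := hp; rewrite has_find in lt7.
by exists (Ordinal lt7); exact: (nth_find [::] hp).
Qed.

(* The rows of [W] are the projections of the rows of [L] on the orthogonal
   complement of the rows of [P]. *)
Lemma gram_schur (C : numClosedFieldType) (m n r : nat) (P : 'M[C]_(m, r))
    (L : 'M[C]_(n, r)) (d : 'I_m -> C) :
  P *m P^t* = diag_mx (\row_p d p) -> (forall p, 0 < d p) ->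
  exists W : 'M[C]_(n, r), (\rank W <= r - m)%N /\
    forall i j, (W *m W^t*) i j = (L *m L^t*) i j
      - \sum_p (L *m P^t*) i p * ((L *m P^t*) j p)^* / d p.
Proof.
move=> PP d0; pose D := diag_mx (\row_p (d p)^-1).
have DD : P *m P^t* *m D = 1%:M.
  rewrite PP mulmx_diag; apply/matrixP => i j; rewrite !mxE.
  by rewrite divff // gt_eqF.
pose B := L *m P^t*; pose W := L - B *m D *m P.
have DC : D^t* = D.
  apply/matrixP => i j; rewrite !mxE rmorphMn /= eq_sym.
  have [->|//] := eqVneq i j; rewrite geC0_conj // invr_ge0 ltW //.
have WP : W *m P^t* = 0.
  rewrite mulmxBl -!mulmxA (mulmxA D).
  have -> : D *m P *m P^t* = 1%:M by rewrite -mulmxA; apply: mulmx1C.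
  by rewrite mulmx1 subrr.
exists W; split.
  have : (W <= kermx (P^t*))%MS by apply/sub_kermxP.
  move/mxrankS; rewrite mxrank_ker => /leq_trans -> //.
  apply: leq_sub2l; apply: leq_trans (mxrankM_maxr P _).
  by rewrite mxrank_unit // (mulmx1_unit DD).1.
move=> i j.
(* As [W] is orthogonal to [P], W W^* = W L^*. *)
have -> : W *m W^t* = L *m L^t* - B *m D *m B^t*.
  have -> : W^t* = L^t* - P^t* *m (B *m D)^t*.
    by rewrite /W linearB /= trmx_mul map_mxB map_mxM.
  rewrite mulmxBr mulmxA WP mul0mx subr0 mulmxBl; congr (_ - _).
  by rewrite /B trmx_mul map_mxM /= trmxCK !mulmxA.
rewrite mxE [in X in _ + X]mxE; congr (_ - _).
by rewrite gram_entry; apply: eq_bigr => p _; rewrite mul_mx_diag !mxE mulrAC.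
Qed.

Lemma heawood_psd_rank_ge (R : realType) (d : nat) :
  psd_rank R heawood d -> (10 <= d)%N.
Proof.
case=> A [psA gA rA]; rewrite leqNgt; apply/negP; rewrite -rA ltnS => rA9.
have [N AE] := psdmx_gram_rank psA rA9.
pose f p : 'I_#|heawood| := enum_rank (inl p : heawood).
pose g l : 'I_#|heawood| := enum_rank (inr l : heawood).
have graph0 u v : u != v -> ~~ adj u v ->
    A (enum_rank (u : heawood)) (enum_rank (v : heawood)) = 0.
  rewrite -gA /mx_adj (inj_eq enum_rank_inj) => -> /=.
  by rewrite negbK => /eqP.
have graph1 p l : (A (g l) (f p) != 0) = fano_incident p l.
  by rewrite -[RHS](gA (inr l) (inl p)) /mx_adj (inj_eq enum_rank_inj).
have z p l : ~~ fano_incident p l -> A (g l) (f p) = 0.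
  by rewrite -graph1 negbK => /eqP.
pose P := rowsub f N; pose L := rowsub g N.
have sub (h k : 'I_7 -> 'I_#|heawood|) i j :
    (rowsub h N *m (rowsub k N)^t*) i j = A (h i) (k j).
  by rewrite AE !gram_entry; apply: eq_bigr => ? _; rewrite !mxE.
(* A zero point-vector would be orthogonal to the lines through the point. *)
have d0 p : 0 < A (f p) (f p).
  have dE : A (f p) (f p) = \sum_k N (f p) k * (N (f p) k)^*.
    by rewrite AE gram_entry.
  have t0 k : 0 <= N (f p) k * (N (f p) k)^* by rewrite mul_conjC_ge0.
  rewrite lt_def dE sumr_ge0 // andbT psumr_eq0 //; apply/negP => /allP N0.
  have [l pl] := fano_point_on_line p.
  move: pl; rewrite -graph1 AE gram_entry big1 ?eqxx // => k _.
  have := N0 k; rewrite mem_index_enum mul_conjC_eq0 => /(_ isT) /eqP ->.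
  by rewrite conjC0 mulr0.
have PP : P *m P^t* = diag_mx (\row_p A (f p) (f p)).
  apply/matrixP => p q; rewrite sub !mxE.
  have [->|pq] := eqVneq p q; first by rewrite mulr1n.
  by rewrite mulr0n graph0.
have [W [rW WE]] := gram_schur L PP d0.
(* The projected line-vectors span at most 9 - 7 = 2 dimensions. *)
have [V VE] : exists V : 'M[R[i]]_(7, 2), W *m W^t* = V *m V^t*.
  apply: psdmx_gram_rank; first exact: gram_psdmx.
  exact: leq_trans (mxrankM_maxl _ _) rW.
have ME p l m : l != m -> fano_incident p l -> fano_incident p m ->
    (V *m V^t*) l m = - (A (g l) (f p) * (A (g m) (f p))^* / A (f p) (f p)).
  move=> lm pl pm; rewrite -VE WE sub graph0 // sub0r; congr (- _).
  rewrite (bigD1 p) //= !sub big1 ?addr0 // => q qp; rewrite !sub.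
  have [ql|nql] := boolP (fano_incident q l); last by rewrite z // !mul0r.
  have [qm|nqm] := boolP (fano_incident q m); last first.
    by rewrite (z _ m) // conjC0 mulr0 mul0r.
  by rewrite (fano_lines_meet lm ql qm pl pm) eqxx in qp.
apply: (@no_planar_fano_gram R V) => p l m k.
rewrite /= !inE negb_or !andbT => /andP[/andP[lm lk] mk] /and3P[pl pm pk].
rewrite (ME p) // (ME p) // (ME p) 1?eq_sym //.
set a := A (g l) _; set b := A (g m) _; set c := A (g k) _; set e := A _ _.
(* Each of [a], [b], [c] meets its own conjugate around the cycle, and three minus signs remain. *)
have -> : - (a * b^* / e) * - (b * c^* / e) * - (c * a^* / e) =
    - ((a * a^*) * (b * b^*) * (c * c^*) / e ^+ 3).
  by rewrite -exprVn; ring.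
rewrite oppr_lt0 divr_gt0 ?exprn_gt0 // ?d0 //.
by apply: mulr_gt0; first apply: mulr_gt0; rewrite mul_conjC_gt0 graph1.
Qed.

(** * A representation in dimension 10 *)

(* Coordinates 7 to 9 are integer vectors w_l such that, for the three lines
   l, m, k through each point, <w_l, w_m> <w_m, w_k> <w_k, w_l> < 0; this sign
   is what allows the first seven coordinates, together with the weights below,
   to cancel all the products <w_l, w_m>. *)
Definition line_rows : seq (seq int) :=
  [:: [:: 5; -20; 0; 0; 0; -3; 0; -1; -3; 1];
      [:: 0; 5; -10; 0; 0; 0; -1; 1; -2; 0];
      [:: -1; 0; 5; -10; 0; 0; 0; 3; -1; 1];
      [:: 0; -4; 0; 10; -10; 0; 0; 3; 1; 2];
      [:: 0; 0; -2; 0; 5; -4; 0; 0; 1; 2];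
      [:: 0; 0; 0; -1; 0; 12; -3; -1; 0; 2];
      [:: -5; 0; 0; 0; -2; 0; 3; -1; -1; 1]].

(** Squared lengths of the coordinate axes: the square roots enter only when the representation is
    built, so the certificate is checked over the integers. *)
Definition weights : seq nat := [:: 12; 3; 6; 6; 6; 5; 20; 60; 60; 60]%N.

Definition heawood_row (u : nat + nat) (k : nat) : int :=
  match u with
  | inl p => (p == k)%:Z
  | inr l => nth 0 (nth [::] line_rows l) k
  end.

Definition weighted_dot (u v : nat + nat) : int :=
  foldr (fun k s =>
      heawood_row u k * heawood_row v k * (nth 0%N weights k)%:Z + s)
    0 (iota 0 10).

Definition nat_vertex (u : heawood) : nat + nat :=
  match u with inl p => inl (p : nat) | inr l => inr (l : nat) end.

Lemma weighted_dot_neq0 (u v : heawood) :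
  u != v -> (weighted_dot (nat_vertex u) (nat_vertex v) != 0) = adj u v.
Proof.
have chk : all (fun i => all (fun j =>
    [&& (i != j) ==> (weighted_dot (inl i) (inl j) == 0),
        (weighted_dot (inl i) (inr j) != 0) == (i.+1 \in nth [::] fano_lines j),
        (weighted_dot (inr j) (inl i) != 0) == (i.+1 \in nth [::] fano_lines j)
      & (i != j) ==> (weighted_dot (inr i) (inr j) == 0)])
    (iota 0 7)) (iota 0 7) by vm_compute.
have io (i : 'I_7) : (i : nat) \in iota 0 7 by rewrite mem_iota ltn_ord.
have {}chk (i j : 'I_7) := and4P (allP (allP chk _ (io i)) _ (io j)).
case: u v => [p|l] [q|m] uv /=.
- have [/implyP/(_ uv)/eqP-> _ _ _] := chk p q.
  by rewrite eqxx.
- by have [_ /eqP-> _ _] := chk p m.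
- by have [_ _ /eqP-> _] := chk q l.
- have [_ _ _ /implyP/(_ uv)/eqP->] := chk l m.
  by rewrite eqxx.
Qed.

Lemma heawood_psd_rank_le (R : realType) :
  exists2 d, (d <= 10)%N & psd_rank R heawood d.
Proof.
pose N : 'M[R[i]]_(#|heawood|, 10) := \matrix_(i, k)
  ((heawood_row (nat_vertex (enum_val i)) k)%:~R *
   sqrtC (nth 0%N weights k)%:R).
exists (\rank (N *m N^t*)).
  exact: leq_trans (mxrankM_maxl _ _) (rank_leq_col _).
exists (N *m N^t*); split=> //; first exact: gram_psdmx.
move=> u v; rewrite /mx_adj (inj_eq enum_rank_inj).
have -> : (N *m N^t*) (enum_rank u) (enum_rank v) =
    (weighted_dot (nat_vertex u) (nat_vertex v))%:~R.
  rewrite gram_entry /weighted_dot.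
  have -> : forall h : nat -> int, foldr (fun k s => h k + s) 0 (iota 0 10) =
      \sum_(k < 10) h k by move=> h; rewrite -(big_mkord xpredT) unlock.
  rewrite rmorph_sum; apply: eq_bigr => k _.
  rewrite !mxE !enum_rankK !rmorphM /= rmorph_int.
  rewrite (geC0_conj (_ : 0 <= sqrtC _)) ?sqrtC_ge0 ?ler0n //.
  by rewrite mulrACA -expr2 sqrtCK.
rewrite intr_eq0; have [->|uv] /= := eqVneq u v.
  by rewrite heawood_adj_irrefl.
exact: weighted_dot_neq0.
Qed.

Theorem theorem3p10 (R : realType) : msr R heawood = 10%N.
Proof.
rewrite /msr; case: ex_minnP => m /asboolP/heawood_psd_rank_ge m10 min.
have [d d10 /asboolP/min md] := heawood_psd_rank_le R.
by apply/eqP; rewrite eqn_leq m10 (leq_trans md).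
Qed.
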